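(* Let $m\neq 1$ be an odd positive integer, not divisible by $31$, having no prime factor in $\mathcal{P}_0$. Write $\omega_j=\omega_j(m)$ for $1\le j\le 5$ and $\omega=\omega_1+\omega_2+\omega_3+\omega_4+\omega_5$. Then: 1) In $\mathbb{Q}_2$, $$mS(m)=2^{\omega_3-1}\,3^{\lceil \frac{\omega_2+\omega_4}{2}-1\rceil}\,E_{\alpha(m)-2\ell(m)}+\frac{0^{\omega_3}}{2}\,3^{\lceil \frac{\omega}{2}-1\rceil}\,F_{a(m)-4\ell(m)}+\frac{0^{\omega_2+\omega_4}}{3}\,2^{\omega-1}(-1)^{\ell(m)}G .$$ 2) $S(31m)=-31^{-1}S(m)$, where $31^{-1}$ is the inverse of $31$ in $\mathbb{Z}_2$. In particular, for every $k\in\{0,1,2,3,4\}$, $2^km\in\mathcal{A}$ if and only if $31\cdot 2^km\in\mathcal{A}$.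
   Context: Let $\mathcal{A}\subseteq\mathbb{N}$ be the unique set of positive integers such that $\prod_{a\in\mathcal{A}}(1-z^a)^{-1}=\sum_{n\ge 0}p(\mathcal{A},n)z^n\equiv 1+z+z^3+z^4+z^5 \pmod 2$ coefficientwise, where $p(\mathcal{A},n)$ is the number of partitions of $n$ with all parts in $\mathcal{A}$. Let $\chi(\mathcal{A},\cdot)$ be its characteristic function and $\sigma(\mathcal{A},n)=\sum_{d\mid n,\,d\in\mathcal{A}}d$. For odd $m$, $S(m)=\sum_{k\ge 0}\chi(\mathcal{A},2^km)2^k\in\mathbb{Z}_2$. For $n$ not divisible by $31$, $\ell(n)\in\mathbb{Z}/6\mathbb{Z}$ is the unique $j$ such that $n\equiv 2^k3^j\pmod{31}$ for some $k\in\{0,\dots,4\}$ ($\ell$ is completely additive mod 6). For $0\le j\le 5$, $\mathcal{P}_j$ is the set of odd primes $p\neq 31$ with $\ell(p)=j$, and $\omega_j(n)$ is the number of distinct prime divisors of $n$ lying in $\mathcal{P}_j$. For $0\le j\le 5$, $U_j\in\mathbb{Z}_2$ is the $2$-adic integer with $U_j\equiv\sigma(\mathcal{A},2^k3^j)\pmod{2^{k+1}}$ for all $k\ge 0$; for $j\in\mathbb{Z}$ set $U_j=U_{j\bmod 6}$. $(v_i)_{i\in\mathbb{Z}}$ is the $12$-periodic sequence with $v_i=\frac{2}{\sqrt3}\cos(i\pi/6)$ for $i$ odd and $v_i=2\cos(i\pi/6)$ for $i$ even; i.e. $(v_0,\dots,v_{11})=(2,1,1,0,-1,-1,-2,-1,-1,0,1,1)$.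 Define $E_i=\sum_{j=0}^5v_{i+2j}U_j$, $F_i=\sum_{j=0}^5v_{i+4j}U_j$ ($i\in\mathbb{Z}$, so indices may be read mod 12) and $G=\sum_{j=0}^5(-1)^jU_j$. $\alpha(m)=2\omega_5-2\omega_1+\omega_4-\omega_2 \bmod 12$ and $a(m)=\omega_5-\omega_1+\omega_2-\omega_4\bmod 12$. Convention: $0^0=1$ and $0^\omega=0$ for $\omega>0$. $\lceil x\rceil$ is the ceiling of $x$. *)

(* Defs.v *)
From HB Require Import structures.
From mathcomp Require Import all_boot all_order all_algebra.
From mathcomp Require Import boolp.

Set Implicit Arguments.
Unset Strict Implicit.
Unset Printing Implicit Defensive.

Import Order.TTheory GRing.Theory Num.Theory.
Local Open Scope ring_scope.

(** A 2-adic integer is a coherent sequence of residues: [res x k] is the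
    representative in [0, 2^k) of [x] modulo [2^k].  The single condition
    [coherent2] forces both the range of [res x k] and the compatibility of
    consecutive residues. *)

Definition coherent2 (u : nat -> int) : Prop :=
  forall k, u k = (u k.+1 %% 2 ^+ k)%Z.

Record Z2 := MkZ2 { res : nat -> int; _ : `[< coherent2 res >] }.

HB.instance Definition _ := [isSub for res].
HB.instance Definition _ := [Choice of Z2 by <:].

Lemma pow2_dvd k : ((2 ^+ k : int) %| 2 ^+ k.+1)%Z.
Proof. by rewrite exprS dvdz_mull. Qed.

Lemma modz_dvdm (a d n : int) : (d %| n)%Z -> ((a %% n)%Z = a %[mod d])%Z.
Proof.
move=> dn; apply/eqP; rewrite eqz_mod_dvd {2}(divz_eq a n) opprD addrCA subrr.
by rewrite addr0 rpredN dvdz_mull.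
Qed.

Lemma mod_pow2S (a : int) k :
  ((a %% 2 ^+ k.+1)%Z = a %[mod 2 ^+ k])%Z.
Proof. by rewrite modz_dvdm ?pow2_dvd. Qed.

Lemma resE (x : Z2) k : (res x k.+1 %% 2 ^+ k)%Z = res x k.
Proof. by case: x => u /= /asboolP cu; rewrite -cu. Qed.

Lemma res_mod (x : Z2) k : (res x k %% 2 ^+ k)%Z = res x k.
Proof. by rewrite -{1}resE modz_mod resE. Qed.

Lemma Z2_ext (x y : Z2) : (forall k, res x k = res y k) -> x = y.
Proof. by move=> exy; apply: val_inj; apply: funext => k; exact: exy. Qed.

Lemma lim2_subproof (u : nat -> int) :
  (forall k, u k.+1 = u k %[mod 2 ^+ k])%Z ->
  `[< coherent2 (fun k => u k %% 2 ^+ k)%Z >].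
Proof. by move=> hu; apply/asboolP => k; rewrite mod_pow2S hu. Qed.

(** The limit in [Z2] of a sequence of integers whose [k]-th term is already
    correct modulo [2^k]. *)
Definition lim2 (u : nat -> int)
    (hu : forall k, (u k.+1 = u k %[mod 2 ^+ k])%Z) : Z2 :=
  MkZ2 (lim2_subproof hu).

Lemma res_lim2 (u : nat -> int) hu k :
  res (@lim2 u hu) k = (u k %% 2 ^+ k)%Z.
Proof. by []. Qed.

Lemma zero2_subproof k : ((fun=> 0) k.+1 = (fun=> 0 : int) k %[mod 2 ^+ k])%Z.
Proof. by []. Qed.

Lemma one2_subproof k : ((fun=> 1) k.+1 = (fun=> 1 : int) k %[mod 2 ^+ k])%Z.
Proof. by []. Qed.

Lemma opp2_subproof x k : (- res x k.+1 = - res x k %[mod 2 ^+ k])%Z.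
Proof. by rewrite -modzNm resE. Qed.

Lemma add2_subproof x y k :
  (res x k.+1 + res y k.+1 = res x k + res y k %[mod 2 ^+ k])%Z.
Proof. by rewrite -modzDm !resE. Qed.

Lemma mul2_subproof x y k :
  (res x k.+1 * res y k.+1 = res x k * res y k %[mod 2 ^+ k])%Z.
Proof. by rewrite -modzMm !resE. Qed.

Definition zero2 := lim2 zero2_subproof.
Definition one2 := lim2 one2_subproof.
Definition opp2 x := lim2 (opp2_subproof x).
Definition add2 x y := lim2 (add2_subproof x y).
Definition mul2 x y := lim2 (mul2_subproof x y).

Lemma add2A : associative add2.
Proof. by move=> x y z; apply: Z2_ext => k /=; rewrite modzDml modzDmr addrA. Qed.

Lemma add2C : commutative add2.
Proof. by move=> x y; apply: Z2_ext => k /=; rewrite addrC. Qed.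

Lemma add02 : left_id zero2 add2.
Proof. by move=> x; apply: Z2_ext => k /=; rewrite modzDml add0r res_mod. Qed.

Lemma addN2 : left_inverse zero2 opp2 add2.
Proof. by move=> x; apply: Z2_ext => k /=; rewrite modzDml addNr. Qed.

HB.instance Definition _ := GRing.isZmodule.Build Z2 add2A add2C add02 addN2.

Lemma mul2A : associative mul2.
Proof. by move=> x y z; apply: Z2_ext => k /=; rewrite modzMml modzMmr mulrA. Qed.

Lemma mul2C : commutative mul2.
Proof. by move=> x y; apply: Z2_ext => k /=; rewrite mulrC. Qed.

Lemma mul12 : left_id one2 mul2.
Proof. by move=> x; apply: Z2_ext => k /=; rewrite modzMml mul1r res_mod. Qed.

Lemma mul2Dl : left_distributive mul2 add2.
Proof.
by move=> x y z; apply: Z2_ext => k /=; rewrite modzMml modzDm mulrDl.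
Qed.

Lemma one2_neq0 : one2 != 0 :> Z2.
Proof. by apply/eqP => /(congr1 (fun x : Z2 => res x 1)). Qed.

HB.instance Definition _ :=
  GRing.Zmodule_isComNzRing.Build Z2 mul2A mul2C mul12 mul2Dl one2_neq0.

Lemma res0 k : res 0 k = 0. Proof. exact: mod0z. Qed.

Lemma resD (x y : Z2) k : res (x + y) k = ((res x k + res y k) %% 2 ^+ k)%Z.
Proof. by []. Qed.

Lemma resN (x : Z2) k : res (- x) k = (- res x k %% 2 ^+ k)%Z.
Proof. by []. Qed.

Lemma resM (x y : Z2) k : res (x * y) k = ((res x k * res y k) %% 2 ^+ k)%Z.
Proof. by []. Qed.

Lemma res_nat (n k : nat) : res n%:R k = (n%:Z %% 2 ^+ k)%Z.
Proof.
elim: n => [|n IHn]; first by rewrite res0 mod0z.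
by rewrite -natr1 resD IHn /= modzDm -[n.+1]addn1 PoszD.
Qed.

Lemma res_int (n : int) k : res n%:~R k = (n %% 2 ^+ k)%Z.
Proof.
case: n => n; first exact: res_nat.
by rewrite NegzE mulrNz resN [res _ _]res_nat modzNm.
Qed.

Lemma res_lift (x : Z2) k i : (res x (k + i) = res x k %[mod 2 ^+ k])%Z.
Proof.
elim: i => [|i IHi]; first by rewrite addn0.
rewrite addnS -IHi -[in RHS]resE modz_dvdm //.
by rewrite exprD dvdz_mulr.
Qed.

Definition unit2 : pred Z2 := fun x => res x 1 == 1.

Lemma res1_unit x k : unit2 x -> (res x k.+1 %% 2)%Z = 1.
Proof. by move=> /eqP ux; rewrite -add1n -[2]expr1 res_lift ux. Qed.

Lemma oddX_pow2 (a : int) k :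
  (a %% 2)%Z = 1 -> (a ^+ (2 ^ k) = 1 %[mod 2 ^+ k])%Z.
Proof.
move=> a1; elim: k => [|k IHk]; first by rewrite !modz1.
apply/eqP; rewrite eqz_mod_dvd expnSr exprM -[X in _ - X](expr1n _ 2) subr_sqr.
rewrite exprSr dvdz_mul //; first by rewrite -eqz_mod_dvd IHk.
apply/dvdz_mod0P; rewrite -modzDml -modzXm a1 expr1n //.
Qed.

Lemma inv2_subproof x k :
  (if unit2 x then res x k.+1 ^+ (2 ^ k.+1).-1 else res x k.+1)%R
  = (if unit2 x then res x k ^+ (2 ^ k).-1 else res x k)%R
  %[mod 2 ^+ k]%Z.
Proof.
case: ifP => ux; last by rewrite resE res_mod.
rewrite -[in RHS]resE modzXm.
have -> : ((2 ^ k.+1).-1 = 2 ^ k + (2 ^ k).-1)%N.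
  by rewrite expnS mul2n -addnn -addn1 -!subn1 addnBA ?expn_gt0 // addn1 subn1.
by rewrite exprD -modzMml oddX_pow2 ?res1_unit // modzMml mul1r.
Qed.

(** The group of odd residues modulo [2^k] has exponent dividing [2^k], whence
    the inverse of an odd residue.  Non-units are left fixed, as required by
    [unitRingType]. *)
Definition inv2 x := lim2 (inv2_subproof x).

Lemma mulV2 : {in unit2, left_inverse 1 inv2 *%R}.
Proof.
move=> x ux; apply: Z2_ext => k; have {}ux : unit2 x := ux.
rewrite resM /= ux modzMml -exprSr prednK ?expn_gt0 //.
by case: k => [|k]; rewrite ?modz1 // oddX_pow2 ?res1_unit.
Qed.

Lemma unit2P x y : y * x = 1 -> unit2 x.
Proof.
move=> /(congr1 (fun z : Z2 => res z 1)); rewrite resM /unit2 -(res_mod x 1).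
have := ltz_pmod (res x 1) (isT : 0 < 2 ^+ 1 :> int).
have := modz_ge0 (res x 1) (isT : 2 ^+ 1 != 0 :> int).
rewrite -modzMmr; case: (_ %% _)%Z => // -[|[|]] //= _ _.
by rewrite mulr0.
Qed.

Lemma inv2_out : {in [predC unit2], inv2 =1 id}.
Proof.
move=> x /negbTE ux; apply: Z2_ext => k; have {}ux : unit2 x = false := ux.
by rewrite /= ux res_mod.
Qed.

HB.instance Definition _ :=
  GRing.ComNzRing_hasMulInverse.Build Z2 mulV2 unit2P inv2_out.

Lemma mul2_eq0 : GRing.integral_domain_axiom Z2.
Proof.
move=> x y xy0; apply/norP => -[x0 y0].
have nz (z : Z2) : z != 0 -> exists i, forall j, ~~ (2 ^+ i %| res z (i + j))%Z.
  move=> /eqP z0; have [i zi] : exists i, res z i <> 0.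
    apply: contrapT => /forallNP h; apply: z0; apply: Z2_ext => i.
    by rewrite res0; apply: contrapT; exact: h.
  exists i => j; apply/negP => /dvdz_mod0P.
  by rewrite res_lift res_mod.
have [[i xi] [j yj]] := (nz _ x0, nz _ y0).
have := resM x y (i + j); rewrite xy0 res0 => /esym /dvdz_mod0P.
have {}xi := xi j; have := yj i; rewrite addnC => {}yj.
rewrite -[in X in (X %| _)%Z]addnC.
move: xi yj; rewrite !dvdzE !abszX abszM /=.
move: `|res x _|%N `|res y _|%N => a b.
case: (posnP a) => [->|a0]; first by rewrite dvdn0.
case: (posnP b) => [->|b0]; first by rewrite dvdn0.
rewrite !pfactor_dvdn ?muln_gt0 ?a0 // lognM // -!ltnNge => la lb.
by rewrite leqNgt addnC -addnS leq_add // ltnW.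
Qed.

HB.instance Definition _ := GRing.ComUnitRing_isIntegral.Build Z2 mul2_eq0.

Lemma odd_unit2 (n : nat) : odd n -> n%:R \is a @GRing.unit Z2.
Proof.
move=> nodd; suff : unit2 n%:R by [].
by rewrite /unit2 res_nat expr1 modz_nat modn2 nodd.
Qed.

Notation Q2 := {fraction Z2}.

(** A partition of [n] is encoded by the multiplicities [f a <= n] of its parts
    [a], with [0 < a <= n]. *)
Definition npart (A : {pred nat}) (n : nat) : nat :=
  #|[set f : {ffun 'I_n.+1 -> 'I_n.+1} |
      (\sum_(a < n.+1) a * f a == n)%N
      & [forall a : 'I_n.+1,
           (0 < f a)%N ==> (0 < a)%N && ((a : nat) \in A)]]|.

Definition parity_set (A : {pred nat}) : Prop :=
  (forall a, a \in A -> (0 < a)%N) /\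
  (forall n, (npart A n)%:R
     = (1 + 'X + 'X^3 + 'X^4 + 'X^5 : {poly 'F_2})`_n :> 'F_2).

Definition chi (A : {pred nat}) (n : nat) : nat := n \in A.

Definition sigma (A : {pred nat}) (n : nat) : nat :=
  (\sum_(d <- divisors n | d \in A) d)%N.

Lemma Sser_subproof (A : {pred nat}) (m k : nat) :
  ((\sum_(i < k.+1) chi A (2 ^ i * m) * 2 ^ i)%N%:Z
    = (\sum_(i < k) chi A (2 ^ i * m) * 2 ^ i)%N%:Z %[mod 2 ^+ k])%Z.
Proof.
apply/eqP; rewrite big_ord_recr /= PoszD eqz_mod_dvd addrAC subrr add0r PoszM.
by rewrite -[(2 ^ k)%N%:Z]natz natrX dvdz_mull.
Qed.

(** The series [\sum_(i >= 0) chi A (2 ^ i * m) * 2 ^ i], as the limit of its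
    partial sums. *)
Definition Sser (A : {pred nat}) (m : nat) : Z2 := lim2 (Sser_subproof A m).

Lemma sigma_double (A : {pred nat}) (k t : nat) : odd t ->
  (sigma A (2 ^ k.+1 * t) = sigma A (2 ^ k * t) %[mod 2 ^ k.+1])%N.
Proof.
move=> todd; have t0 : (0 < t)%N by case: t todd.
set n := (2 ^ k * t)%N; set n2 := (2 ^ k.+1 * t)%N.
have n0 : (0 < n)%N by rewrite muln_gt0 expn_gt0.
have n20 : (0 < n2)%N by rewrite muln_gt0 expn_gt0.
rewrite /sigma (bigID (fun d => d %| n)%N) /=.
rewrite -modnDmr; set r := (X in (_ + X %% _)%N).
have /eqP -> : (2 ^ k.+1 %| r)%N.
  rewrite /r big_seq_cond; apply: dvdn_sum => d /and3P[].
  rewrite -dvdn_divisors // => dn2 _ dn.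
  have d0 := dvdn_gt0 n20 dn2.
  rewrite pfactor_dvdn // ltnNge; apply: contra dn => ld.
  have [q cq dE] := pfactor_coprime (isT : prime 2) d0.
  move: dn2; rewrite dE => /(dvdn_trans (dvdn_mulr _ (dvdnn q))).
  rewrite Gauss_dvdr ?coprimeXr // 1?coprime_sym // => qt.
  by rewrite mulnC dvdn_mul // dvdn_exp2l.
rewrite addn0; congr (_ %% _)%N.
rewrite -big_filter -[RHS]big_filter; apply: perm_big.
apply: uniq_perm; rewrite ?filter_uniq ?divisors_uniq // => d.
rewrite !mem_filter -!dvdn_divisors //.
case dn: (d %| n)%N; rewrite ?andbF //= andbT.
by rewrite (dvdn_trans dn) ?andbT // dvdn_mul // dvdn_exp2l.
Qed.

Lemma Uj_subproof (A : {pred nat}) (j : 'I_6) (k : nat) :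
  ((sigma A (2 ^ k.+1 * 3 ^ j))%:Z
    = (sigma A (2 ^ k * 3 ^ j))%:Z %[mod 2 ^+ k])%Z.
Proof.
have /sigma_double : odd (3 ^ j) by rewrite oddX orbT.
move=> /(_ A k) /(congr1 (fun n => (n%:Z %% 2 ^+ k)%Z)).
by rewrite -!modz_nat -[(2 ^ k.+1)%N%:Z]natz natrX !mod_pow2S.
Qed.

Definition Uj (A : {pred nat}) (j : 'I_6) : Z2 := lim2 (Uj_subproof A j).

(** [lim2] only records the congruences modulo [2^k]; they do hold modulo
    [2^(k+1)], and this characterizes [Uj]. *)
Lemma UjP (A : {pred nat}) (j : 'I_6) (u : Z2) :
  u = Uj A j <->
  forall k, res u k.+1 = ((sigma A (2 ^ k * 3 ^ j))%:Z %% 2 ^+ k.+1)%Z.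
Proof.
have hU k : res (Uj A j) k.+1 = ((sigma A (2 ^ k * 3 ^ j))%:Z %% 2 ^+ k.+1)%Z.
  rewrite res_lim2 -[2 ^+ k.+1](natrX int 2) natz !modz_nat.
  by rewrite sigma_double // oddX orbT.
split=> [-> //|hu]; apply: Z2_ext => -[|k]; last by rewrite hu hU.
by rewrite -[LHS]resE -[RHS]resE hu hU.
Qed.

(** [vseq i] is [2 * cos (i * pi / 6)] for [i] even, and this value divided by
    [sqrt 3] for [i] odd. *)
Definition vseq (i : int) : int :=
  nth 0 [:: 2; 1; 1; 0; -1; -1; -2; -1; -1; 0; 1; 1] `|(i %% 12)%Z|.

Definition Ecoef (A : {pred nat}) (i : int) : Z2 :=
  \sum_(j < 6) (vseq (i + 2 * (j : nat)%:Z))%:~R * Uj A j.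

Definition Fcoef (A : {pred nat}) (i : int) : Z2 :=
  \sum_(j < 6) (vseq (i + 4 * (j : nat)%:Z))%:~R * Uj A j.

Definition Gcoef (A : {pred nat}) : Z2 := \sum_(j < 6) (-1) ^+ j * Uj A j.

(** The class in Z/6 is represented in [0, 6); the value is a junk 0 when 31
    divides [n]. *)
Definition ell (n : nat) : nat :=
  odflt ord0 [pick j : 'I_6 |
    [exists k : 'I_5, n == 2 ^ k * 3 ^ j %[mod 31]]%N].

Definition inPj (j p : nat) : bool :=
  [&& prime p, odd p, p != 31%N & ell p == j].

Definition omega (j n : nat) : nat := count (inPj j) (primes n).

(** Only the classes of [alpha m] and [aexp m] modulo 12 matter: they index the
    12-periodic [Ecoef A] and [Fcoef A]. *)
Definition alpha (m : nat) : int :=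
  2 * (omega 5 m)%:Z - 2 * (omega 1 m)%:Z + (omega 4 m)%:Z - (omega 2 m)%:Z.

Definition aexp (m : nat) : int :=
  (omega 5 m)%:Z - (omega 1 m)%:Z + (omega 2 m)%:Z - (omega 4 m)%:Z.

(* Main.v *)
Require Import Defs.
From mathcomp Require Import all_boot all_order all_algebra.
From mathcomp Require Import ring lra zify.

(** The identity [f = P] modulo 2, where [f] is the generating function of
    [npart A] and [P = 1 + z + z^3 + z^4 + z^5], passes to logarithmic
    derivatives with a gain: modulo [2^k] and for [2^k] dividing [N], [sigma A N]
    is minus the [N]-th power sum of the inverse roots of [P].  As these roots
    have order 31 modulo 2, [sigma A (2^k * n)] modulo [2^k] only depends on
    [n] modulo 31, and, by doubling, only on [n] modulo 31 and powers of 2.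
    Hence, for [n] odd, [\sum_(d | n) d * S(d)] is [U_(ell n)] if 31 does not
    divide [n], and a constant otherwise.

    Moebius inversion then reads [m * S(m) = \prod_(p | m) (1 - T^(ell p)) U],
    evaluated at [ell m], where [T] is the shift on functions on Z/6.  The
    eigenvalues of [T] are the sixth roots of unity: the primitive ones give
    the [E] term, those of order 3 the [F] term, and -1 the [G] term. *)

Set Implicit Arguments.
Unset Strict Implicit.
Unset Printing Implicit Defensive.

Import Order.TTheory GRing.Theory Num.Theory.
Local Open Scope ring_scope.

(** * Logarithmic derivatives modulo powers of 2 *)

(** Truncated logarithmic derivative: when [D] has constant term 1, [S] is the series - z D'/D up to
    degree [L]. For a product of factors 1 - r z its coefficients are the power sums of the r. *)
Definition newton (L : nat) (D S : {poly int}) : Prop :=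
  exists R, 'X * D^`() + D * S = R * 'X^(L.+1).

Lemma newton1 L : newton L 1 0.
Proof. by exists 0; rewrite derivC !mulr0 addr0 mul0r. Qed.

Lemma newtonM L D1 S1 D2 S2 :
  newton L D1 S1 -> newton L D2 S2 -> newton L (D1 * D2) (S1 + S2).
Proof.
move=> [R1 e1] [R2 e2]; exists (D2 * R1 + D1 * R2).
by rewrite mulrDl -!mulrA -e1 -e2 derivM; ring.
Qed.

Lemma newton_prod L (I : Type) (r : seq I) (Q : pred I) (D S : I -> {poly int}) :
    (forall i, Q i -> newton L (D i) (S i)) ->
  newton L (\prod_(i <- r | Q i) D i) (\sum_(i <- r | Q i) S i).
Proof.
move=> h; elim/big_rec2: _ => [|i S' D' Qi IH]; first exact: newton1.
exact: newtonM (h i Qi) IH.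
Qed.

Lemma newton_oneBXn L a : (0 < a)%N ->
  newton L (1 - 'X^a) (a%:R * \sum_(1 <= j < L.+2) 'X^(a * j)).
Proof.
(* The geometric sum telescopes against [1 - 'X^a]; the witness comes from its tail, of degree
   [a * L.+2], divided by ['X^(L.+1)]. *)
move=> a0; exists (- a%:R * 'X^(a * L.+2 - L.+1)).
have hs : (1 - 'X^a) * \sum_(1 <= j < L.+2) 'X^(a * j) = 'X^a - 'X^(a * L.+2) :> {poly int}.
  elim: L => [|L IH]; first by rewrite big_nat1 muln1 mulrBl mul1r -exprD muln2 addnn.
  rewrite big_nat_recr //= mulrDr IH mulrBl mul1r -exprD -mulnS; ring.
rewrite mulrCA hs derivB derivC derivXn sub0r -mulrA -exprD subnK; last by nia.
rewrite -mulr_natl -[in 'X^(a.-1)]subn1 mulrN mulrCA -exprS -subSn // subn1 /=.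
by ring.
Qed.

(** The factor ['X] restores the degree lost by derivation, so [D] only matters modulo
    ['X^(L.+1)]. *)
Lemma newton_truncate L (D S r : {poly int}) :
  newton L (D + r * 'X^(L.+1)) S -> newton L D S.
Proof.
move=> [R e]; exists (R - 'X * r^`() - r * L.+1%:R - r * S).
rewrite !mulrBl -e derivD derivM derivXn -[_ *+ L.+1]mulr_natl exprS /=; ring.
Qed.

(** The gain of powers of 2: [S] is minus z times the derivative of log(1 + 2h), a series with terms
    2^(i+1) h^(i+1) / (i+1) up to sign. In degree [N] the derivation brings a factor [N], while
    2^(i+1) / (i+1) has odd denominator. *)
Lemma newton_mod2 L (h S : {poly int}) (N k : nat) :
  newton L (1 + 2 * h) S -> (N <= L)%N -> (2 ^ k %| N)%N ->
  (2 ^+ k %| S`_N)%Z.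
Proof.
move=> [R e] NL kN.
(* geometric series: invert [1 + 2 h] modulo [2^k] *)
have geo : (1 + 2 * h) * \sum_(i < k) (- (2 * h)) ^+ i = 1 - (- (2 * h)) ^+ k.
  by rewrite -[RHS]opprB subrX1 -[RHS]mulNr opprB opprK.
(* Modulo [2 ^+ k] and up to degree [L], only the first [k] terms of the logarithmic series
   remain. *)
have eS : S = 2 ^+ k * ((-1) ^+ k * h ^+ k * S)
    + (R * \sum_(i < k) (- (2 * h)) ^+ i) * 'X^(L.+1)
    - \sum_(i < k) 2 ^+ i.+1 * ((-1) ^+ i * ('X * (h^`() * h ^+ i))).
  have e2 : (1 + 2 * h) * S = R * 'X^(L.+1) - 2 * ('X * h^`()).
    rewrite -e derivD derivC derivM -[2]/(2%:R) -[X in X%:R]/2%N -polyCMn derivC; ring.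
  have {}e2 := congr1 (fun p => p * \sum_(i < k) (- (2 * h)) ^+ i) e2.
  move: e2; rewrite mulrAC geo mulrBl => e2.
  have -> : \sum_(i < k) 2 ^+ i.+1 * ((-1) ^+ i * ('X * (h^`() * h ^+ i)))
      = 2 * ('X * h^`()) * \sum_(i < k) (- (2 * h)) ^+ i.
    rewrite mulr_sumr; apply: eq_bigr => i _.
    by rewrite -[- (2 * h)]mulN1r !exprMn exprS; ring.
  have {1}-> : S = (- (2 * h)) ^+ k * S + (1 * S - (- (2 * h)) ^+ k * S) by ring.
  rewrite e2 -[- (2 * h) in X in X + _]mulN1r !exprMn; ring.
have coefX2 i (p : {poly int}) : (2 ^+ i * p)`_N = 2 ^+ i * p`_N.
  by rewrite -!natrX !mulr_natl coefMn.
rewrite eS coefB coefD coefMXn ltnS NL addr0 coefX2 rpredB ?dvdz_mulr // coef_sum.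
apply: rpred_sum => i _.
rewrite coefX2 -signr_odd mulr_sign.
set t := ('X * (h^`() * h ^+ i))`_N.
have tE : i.+1%:R * t = N%:R * (h ^+ i.+1)`_N.
  have := congr1 (fun p => ('X * p)`_N) (deriv_exp h i.+1).
  rewrite /t !coefXM; case: (N) => [|M] /=; first by rewrite mulr0 mul0r.
  by rewrite coef_deriv coefMn !mulr_natl.
suff : (2 ^+ k %| 2 ^+ i.+1 * t)%Z.
  by case: odd => //=; rewrite coefN mulrN rpredN.
(* Write [i.+1 = b * 2 ^ a] with [b] odd: [b] is prime to [2 ^+ k] and cancels, and [2 ^ a] is
   absorbed in [2 ^+ i.+1] as [a <= i.+1]. *)
have [b ob ib] := pfactor_coprime (isT : prime 2) (ltn0Sn i).
set a := logn 2 i.+1 in ib.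
have ai : (a <= i.+1)%N.
  rewrite ltnW // -(ltn_exp2l _ _ (isT : 1 < 2)%N).
  by rewrite (leq_ltn_trans _ (ltn_expl i.+1 _)) // dvdn_leq // pfactor_dvdnn.
have : (2 ^+ k %| (b * 2 ^ a)%:R * t)%Z.
  by rewrite -ib tE dvdz_mulr // -natrX !natz.
rewrite natrM -mulrA Gauss_dvdzr; last first.
  by rewrite coprimezE abszX !natz; apply: coprimeXl; exact: ob.
rewrite natrX => kt; apply: dvdz_trans kt _.
by rewrite dvdz_mul // dvdz_exp2l.
Qed.

(** * The Euler product of [A] *)

Definition euler_prod (A : {pred nat}) (L : nat) : {poly int} :=
  \prod_(0 <= a < L.+1 | a \in A) (1 - 'X^a).

Definition geom_prod (A : {pred nat}) (L : nat) : {poly int} :=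
  \prod_(0 <= a < L.+1 | a \in A) \sum_(0 <= i < L.+1) 'X^(a * i).

Lemma sum_eq_muln (a n L : nat) : (0 < n <= L)%N ->
  (\sum_(1 <= j < L.+2) (n == a * j) = (a %| n))%N.
Proof.
move=> /andP[n0 nL]; case: (boolP (a %| n)%N) => [/dvdnP[q qE]|an].
  have [a0 q0] : (0 < a)%N /\ (0 < q)%N by move: n0; rewrite qE muln_gt0 => /andP[].
  rewrite (bigD1_seq q) ?iota_uniq ?mem_index_iota ?q0 //=; last by nia.
  rewrite qE mulnC eqxx big1 // => j jq; apply/eqP; rewrite eqb0.
  by apply: contra jq; rewrite eqn_pmul2l // eq_sym.
apply: big1 => j _; apply/eqP; rewrite eqb0; apply: contra an => /eqP ->.
exact: dvdn_mulr.
Qed.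

(** A Lambert series: [a] contributes once for each [j] with [a * j = n], hence exactly when it
    divides [n]. *)
Lemma coef_newton_euler_prod (A : {pred nat}) (n L : nat) : (0 < n <= L)%N ->
  (\sum_(0 <= a < L.+1 | a \in A)
     (a%:R * \sum_(1 <= j < L.+2) 'X^(a * j)) : {poly int})`_n = (sigma A n)%:R.
Proof.
move=> hn; have /andP[n0 nL] := hn; rewrite coef_sum.
under eq_bigr => a _.
  rewrite mulr_natl coefMn coef_sum.
  under eq_bigr => j _ do rewrite coefXn.
  rewrite -natr_sum sum_eq_muln // -mulrnA.
  over.
rewrite -natr_sum /sigma; congr (_%:R).
under eq_bigr => a _ do rewrite mulnbl.
rewrite -big_mkcondr /= -big_filter -[RHS]big_filter; apply: perm_big.
apply: uniq_perm; rewrite ?filter_uniq ?divisors_uniq ?iota_uniq // => a.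
rewrite !mem_filter -dvdn_divisors // mem_index_iota /= -andbA.
case an: (a %| n)%N => //=; congr (_ && _); rewrite ltnS.
by apply: leq_trans nL; apply: dvdn_leq.
Qed.

(** Expanding the product chooses an exponent for every [a], that is, a function of multiplicities
    as in [npart]. *)
Lemma coef_geom_prod (A : {pred nat}) (n : nat) :
  (forall a, a \in A -> (0 < a)%N) -> (geom_prod A n)`_n = (npart A n)%:R.
Proof.
move=> A0.
(* Extending the product to all [a], with zero terms for forbidden multiplicities, gives the sums a
   common index set for distributivity. *)
pose F (a i : 'I_n.+1) : {poly int} :=
  if (0 < i)%N ==> (0 < a)%N && ((a : nat) \in A) then 'X^(a * i) else 0.
have -> : geom_prod A n = \prod_(a < n.+1) \sum_(i < n.+1) F a i.
  rewrite /geom_prod big_mkcond big_mkord; apply: eq_bigr => a _.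
  case: ifP => aA.
    by rewrite big_mkord; apply: eq_bigr => i _; rewrite /F aA (A0 _ aA) implybT.
  rewrite (bigD1 ord0) //= big1 ?addr0 ?/F /= ?muln0 // => i i0.
  by rewrite aA andbF implybF -eqn0Ngt ifN.
rewrite bigA_distr_bigA coef_sum /npart -sum1_card natr_sum [RHS]big_mkcond.
apply: eq_bigr => f _; rewrite inE.
case: (boolP [forall a, _]) => [/forallP h|/forallPn[a ha]].
  rewrite (eq_bigr (fun a : 'I_n.+1 => 'X^(a * f a))); last by move=> a _; rewrite /F h.
  by rewrite -expr_sum coefXn eq_sym andbT; case: eqP.
by rewrite andbF (bigD1 a) //= {1}/F (negbTE ha) mul0r coef0.
Qed.

Lemma prod_trunc (I : Type) (r : seq I) (Q : pred I) (n : nat)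
    (F : I -> {poly int}) :
    (forall i, Q i -> exists s, F i = 1 + s * 'X^n) ->
  exists s, \prod_(i <- r | Q i) F i = 1 + s * 'X^n.
Proof.
move=> h; elim/big_rec: _ => [|i p /h[s ->] [t ->]].
  by exists 0; rewrite mul0r addr0.
by exists (s + t + s * t * 'X^n); ring.
Qed.

Lemma euler_geom_prod (A : {pred nat}) (L : nat) :
  (forall a, a \in A -> (0 < a)%N) ->
  exists r, euler_prod A L * geom_prod A L = 1 + r * 'X^(L.+1).
Proof.
move=> A0; rewrite -big_split; apply: prod_trunc => a /A0 a0 /=.
have -> : (1 - 'X^a) * \sum_(0 <= i < L.+1) 'X^(a * i) = 1 - 'X^(a * L.+1) :> {poly int}.
  rewrite big_mkord -[RHS]opprB exprM subrX1 -[RHS]mulNr opprB.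
  by congr (_ * _); apply: eq_bigr => i _; rewrite exprM.
exists (- 'X^(a * L.+1 - L.+1)).
by rewrite mulNr -exprD subnK // leq_pmull.
Qed.

(** The Euler products for [n] and [L] agree modulo ['X^(n.+1)], hence so do their inverses
    [geom_prod A n] and [geom_prod A L]. *)
Lemma coef_geom_prod_wide (A : {pred nat}) (n L : nat) :
    (forall a, a \in A -> (0 < a)%N) -> (n <= L)%N ->
  (geom_prod A L)`_n = (npart A n)%:R.
Proof.
move=> A0 nL; rewrite -coef_geom_prod //.
have [r1 e1] := euler_geom_prod n A0; have [r2 e2] := euler_geom_prod L A0.
have [r3 e3] : exists r, euler_prod A L = euler_prod A n * (1 + r * 'X^(n.+1)).
  have [s es] : exists s,
      \prod_(n.+1 <= a < L.+1 | a \in A) (1 - 'X^a) = 1 + s * 'X^(n.+1) :> {poly int}.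
    rewrite big_nat_cond; apply: prod_trunc => a /andP[/andP[na _] _].
    by exists (- 'X^(a - n.+1)); rewrite mulNr -exprD subnK.
  by exists s; rewrite -es /euler_prod (@big_cat_nat _ _ _ n.+1).
have e4 : 'X^(L.+1) = 'X^(L - n) * 'X^(n.+1) :> {poly int}.
  by rewrite -exprD addnS subnK.
set E := euler_prod A n in e1 e3; set F := geom_prod A n in e1 *.
set H := geom_prod A L in e2 *.
suff -> : H = F + (F * r2 * 'X^(L - n) - r3 * E * H * F - r1 * H) * 'X^(n.+1).
  by rewrite coefD coefMXn ltnSn addr0.
have h1 : H * (E * F) = H * (1 + r1 * 'X^(n.+1)) by rewrite e1.
have h2 : F * (E * (1 + r3 * 'X^(n.+1)) * H) = F * (1 + r2 * ('X^(L - n) * 'X^(n.+1))).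
  by rewrite -e3 e2 e4.
have hH : H = H * (E * F) - r1 * H * 'X^(n.+1) by rewrite h1; ring.
have hF : H * (E * F) = F * (1 + r2 * ('X^(L - n) * 'X^(n.+1))) - r3 * E * H * F * 'X^(n.+1).
  by rewrite -h2; ring.
by rewrite {1}hH hF; ring.
Qed.

(** * Power sums *)

Lemma poly_trunc0 (L : nat) (p : {poly int}) :
  (forall n, (n <= L)%N -> p`_n = 0) -> exists r, p = r * 'X^(L.+1).
Proof.
move=> p0; exists (drop_poly L.+1 p); rewrite -[LHS](poly_take_drop L.+1 p).
suff -> : take_poly L.+1 p = 0 by rewrite add0r.
apply/polyP => n; rewrite coef_take_poly coef0 ltnS.
by case: leqP => // /p0.
Qed.

Lemma poly_trunc_mod2 (L : nat) (p : {poly int}) :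
    (forall n, (n <= L)%N -> (2 %| p`_n)%Z) ->
  exists h r, p = 2 * h + r * 'X^(L.+1).
Proof.
move=> p2; pose h : {poly int} := \poly_(i < L.+1) (p`_i %/ 2)%Z.
have [|r pr] := @poly_trunc0 L (p - 2 * h).
  move=> n nL; rewrite coefB -[2]/(2%:R) mulr_natl coefMn coef_poly ltnS nL.
  by rewrite -[(_ %/ _)%Z *+ 2]mulr_natr divzK ?subrr // p2.
by exists h, r; rewrite -pr addrC subrK.
Qed.

Definition quintic : {poly int} := 1 + 'X + 'X^3 + 'X^4 + 'X^5.

Definition psum_step (t : int * int * int * int * int) :=
  let '(a, b, c, d, e) := t in (b, c, d, e, - (e + c + b + a)).

(* The power sums of the inverse roots of [quintic], from Newton's identities. *)
Definition psum (n : nat) : int :=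
  let '(a, _, _, _, _) := iter n psum_step (5, -1, 1, -4, 1) in a.

Lemma psum_rec n :
  psum n.+4.+1 = - (psum n.+4 + psum n.+2 + psum n.+1 + psum n).
Proof. by rewrite /psum !iterS; case: (iter n _ _) => [[[[a b] c] d] e]. Qed.

Lemma newton_quintic L :
  exists2 S : {poly int}, newton L quintic S
    & forall n, (0 < n <= L)%N -> S`_n = psum n.
Proof.
pose F : {poly int} := \poly_(i < L.+1) psum i.
(* The constant term [psum 0 = 5] is removed, since - z D'/D has none. *)
exists (F - 5%:R%:P); last first.
  by move=> n /andP[n0 nL]; rewrite coefB coefC coef_poly ltnS nL gtn_eqF ?subr0.
apply: poly_trunc0 => n nL.
(* The last bracket is z P' - 5 P for P the quintic. It matches the initial values in degrees below
   5; beyond, [psum_rec] applies. *)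
have -> : 'X * quintic^`() + quintic * (F - 5%:R%:P)
   = F + 'X^1 * F + 'X^3 * F + 'X^4 * F + 'X^5 * F
     + (- 5%:R%:P - 4%:R%:P * 'X^1 - 2%:R%:P * 'X^3 - 'X^4).
  rewrite /quintic !derivE !polyCMn /=; ring.
have Fi i : (i <= n)%N -> F`_(n - i) = psum (n - i).
  by move=> ni; rewrite coef_poly ltnS (leq_trans (leq_subr i n)).
rewrite !(coefD, coefN, coefXnM, coefCM, coefC, coefXn, coefB).
have -> : F`_n = psum n by rewrite -(subn0 n) Fi.
move: Fi nL; case: n => [|[|[|[|[|n]]]]] Fi nL //=; rewrite ?Fi //.
by rewrite !subSS !subn0 psum_rec; ring.
Qed.

(** Modulo 2 and up to degree [N], [quintic] is inverse to the Euler product of [A]. Their product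
    is thus 1 modulo 2, with logarithmic derivative the sum of both, and [newton_mod2] applies. *)
Lemma sigma_psum (A : {pred nat}) (N k : nat) :
    parity_set A -> (0 < N)%N -> (2 ^ k %| N)%N ->
  (2 ^+ k %| (sigma A N)%:R + psum N)%Z.
Proof.
move=> [A0 HA] N0 kN.
have [h [r hr]] : exists h r, geom_prod A N - quintic = 2 * h + r * 'X^(N.+1).
  apply: poly_trunc_mod2 => n nN; rewrite coefB coef_geom_prod_wide //.
  have chF : 2%N \in [pchar 'F_2] by exact: pchar_Fp.
  rewrite -[2]/(2%N%:Z) (dvdz_pcharf chF) rmorphB /= rmorph_nat HA subr_eq0; apply/eqP.
  by rewrite !(coefD, coefXn, coefX, coef1) !rmorphD /= !rmorph_nat.
have [r2 e2] := euler_geom_prod N A0.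
have [S nS Sn] := newton_quintic N.
have nD : newton N (euler_prod A N) (\sum_(0 <= a < N.+1 | a \in A)
    (a%:R * \sum_(1 <= j < N.+2) 'X^(a * j))).
  by apply: newton_prod => a /A0; apply: newton_oneBXn.
have := newtonM nD nS.
have -> : euler_prod A N * quintic = 1 + 2 * (- h * euler_prod A N)
    + (r2 - r * euler_prod A N) * 'X^(N.+1).
  have -> : quintic = geom_prod A N - (2 * h + r * 'X^(N.+1)) by rewrite -hr; ring.
  by rewrite mulrBr e2; ring.
move=> /newton_truncate /newton_mod2 /(_ (leqnn N) kN).
by rewrite coefD coef_newton_euler_prod ?N0 ?leqnn // Sn ?N0 ?leqnn.
Qed.

(** * Periodicity modulo 31 of the power sums and of [sigma] *)

Definition psum_form (p : {poly int}) : int := \sum_(i < size p) p`_i * psum i.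

Lemma psum_formE (N : nat) (p : {poly int}) : (size p <= N)%N ->
  psum_form p = \sum_(i < N) p`_i * psum i.
Proof.
move=> pN; rewrite /psum_form (big_ord_widen N (fun i => p`_i * psum i)) //.
rewrite big_mkcond; apply: eq_bigr => i _.
by case: ltnP => // ip; rewrite nth_default ?mul0r.
Qed.

Lemma psum_formD p q : psum_form (p + q) = psum_form p + psum_form q.
Proof.
set N := maxn (size p) (size q).
rewrite !(@psum_formE N) ?leq_maxl ?leq_maxr ?size_polyD // -big_split.
by apply: eq_bigr => i _; rewrite coefD mulrDl.
Qed.

Lemma psum_form_natM (n : nat) p : psum_form (n%:R * p) = n%:R * psum_form p.
Proof.
rewrite !mulr_natl; elim: n => [|n IH]; last by rewrite !mulrS psum_formD IH.
by rewrite /psum_form size_poly0 big_ord0.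
Qed.

Lemma psum_formXnM n p :
  psum_form ('X^n * p) = \sum_(i < size p) p`_i * psum (n + i).
Proof.
rewrite (@psum_formE (n + size p)); last first.
  by rewrite (leq_trans (size_polyMleq _ _)) // size_polyXn.
rewrite big_split_ord /= big1 ?add0r => [|i _]; last by rewrite coefXnM ltn_ord mul0r.
by apply: eq_bigr => i _; rewrite coefXnM ltnNge leq_addr addKn.
Qed.

Definition rec_quintic : {poly int} := 1 + 'X^1 + 'X^2 + 'X^4 + 'X^5.

(** [rec_quintic] is the characteristic polynomial of the recurrence of [psum], so the form sending
    ['X^i] to [psum i] kills its multiples. Congruences between power sums thus follow from
    congruences between monomials modulo [rec_quintic]. *)
Lemma psum_form_quintic p : psum_form (rec_quintic * p) = 0.
Proof.
rewrite !mulrDl -[1]/('X^0) !psum_formD !psum_formXnM -!big_split /=.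
by apply: big1 => i _; rewrite !addSn !add0n psum_rec; ring.
Qed.

Lemma psum_formXn n : psum_form 'X^n = psum n.
Proof.
rewrite -[X in psum_form X]mulr1 psum_formXnM size_poly1 big_ord1 coef1.
by rewrite mul1r addn0.
Qed.

(* The witness [C] lifts the quotient of [X ^ 31 - 1] by [rec_quintic] over F_2. *)
Lemma polyX31 : exists Y C : {poly int}, 'X^31 = 1 + 2 * Y + rec_quintic * C.
Proof.
pose x : {poly int} := 'X.
exists (- 1 - x - x ^+ 2 - x ^+ 3 - x ^+ 4 - 2 * x ^+ 5 - x ^+ 6 - x ^+ 7
  - x ^+ 8 - x ^+ 9 - x ^+ 10 - x ^+ 12 - x ^+ 13 - x ^+ 14 - x ^+ 15 - 2 *
  x ^+ 16 - 2 * x ^+ 17 - 2 * x ^+ 18 - 2 * x ^+ 19 - 2 * x ^+ 20 - 2 * x ^+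
  21 - 2 * x ^+ 22 - x ^+ 23 - x ^+ 24 - 2 * x ^+ 25 - 2 * x ^+ 26 - x ^+ 27
  - x ^+ 28 - x ^+ 29 - x ^+ 30).
exists (1 + x + x ^+ 3 + x ^+ 5 + x ^+ 8 + x ^+ 12 + x ^+ 14 + x ^+ 15 + x
  ^+ 16 + x ^+ 17 + x ^+ 18 + x ^+ 20 + x ^+ 21 + x ^+ 24 + x ^+ 25 + x ^+
  26).
rewrite /rec_quintic /x; ring.
Qed.

(** Squaring a polynomial congruent to 1 modulo [2 ^+ k.+1] gains one power of 2. *)
Lemma polyX31_pow2 k :
  exists Y C : {poly int}, 'X^(31 * 2 ^ k) = 1 + 2 ^+ k.+1 * Y + rec_quintic * C.
Proof.
elim: k => [|k [Y [C e]]]; first exact: polyX31.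
exists (Y + 2 ^+ k * Y ^+ 2), (C * (2 * (1 + 2 ^+ k.+1 * Y) + rec_quintic * C)).
by rewrite expnSr mulnA exprM e !exprS; ring.
Qed.

Lemma polyX31_pow2M k t :
  exists Y C : {poly int}, 'X^(31 * 2 ^ k * t) = 1 + 2 ^+ k * Y + rec_quintic * C.
Proof.
have [Y [C e]] := polyX31_pow2 k; elim: t => [|t [Y1 [C1 e1]]].
  by exists 0, 0; rewrite muln0; ring.
exists (2 * Y + Y1 + 2 ^+ k * 2 * Y * Y1).
exists (C * (1 + 2 ^+ k * Y1 + rec_quintic * C1) + (1 + 2 * 2 ^+ k * Y) * C1).
by rewrite mulnS exprD e e1 exprS; ring.
Qed.

(** Multiply the congruence for ['X^(31 * 2 ^ k * t)] by ['X^(2 ^ k * n)] and apply [psum_form]. *)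
Lemma psum_periodic (k n t : nat) :
  (2 ^+ k %| psum (2 ^ k * (n + 31 * t)) - psum (2 ^ k * n))%Z.
Proof.
have [Y [C e]] := polyX31_pow2M k t.
have -> : psum (2 ^ k * (n + 31 * t)) = psum (2 ^ k * n)
    + 2 ^+ k * psum_form ('X^(2 ^ k * n) * Y).
  rewrite -psum_formXn mulnDr exprD mulnCA mulnA e.
  rewrite -[RHS]addr0 -(psum_form_quintic ('X^(2 ^ k * n) * C)).
  rewrite -!natrX -psum_form_natM -psum_formXn -!psum_formD.
  by congr psum_form; ring.
by rewrite addrAC subrr add0r dvdz_mulr.
Qed.

Lemma sigma_mod31 (A : {pred nat}) (k n n' : nat) :
    parity_set A -> (0 < n)%N -> (0 < n')%N -> (n = n' %[mod 31])%N ->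
  (sigma A (2 ^ k * n) = sigma A (2 ^ k * n') %[mod 2 ^ k])%N.
Proof.
move=> HA; wlog nn' : n n' / (n' <= n)%N => [hw n0 n'0 e|n0 n'0 /eqP e].
  by case/orP: (leq_total n' n) => ?; [|apply: esym]; apply: hw.
have [t nE] : exists t, n = (n' + 31 * t)%N.
  move: e; rewrite eqn_mod_dvd // => /dvdnP[t tE]; exists t.
  by rewrite mulnC -tE subnKC.
have h1 := sigma_psum HA (_ : 0 < 2 ^ k * n)%N (dvdn_mulr n (dvdnn (2 ^ k))).
have h2 := sigma_psum HA (_ : 0 < 2 ^ k * n')%N (dvdn_mulr n' (dvdnn (2 ^ k))).
have {}h1 := h1 ltac:(by rewrite muln_gt0 expn_gt0).
have {}h2 := h2 ltac:(by rewrite muln_gt0 expn_gt0).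
have h3 := psum_periodic k n' t; rewrite -nE in h3.
suff : ((sigma A (2 ^ k * n))%:Z == (sigma A (2 ^ k * n'))%:Z %[mod (2 ^ k)%N%:Z])%Z.
  by rewrite !modz_nat => /eqP[].
rewrite eqz_mod_dvd -[X in (X %| _)%Z]natz natrX -!(natz (sigma _ _)).
set s := (sigma A _)%:R in h1 *; set s' := (sigma A _)%:R in h2 *.
have -> : s - s' = (s + psum (2 ^ k * n)) - (s' + psum (2 ^ k * n'))
   - (psum (2 ^ k * n) - psum (2 ^ k * n')) by ring.
exact: (rpredB (rpredB h1 h2) h3).
Qed.

(** Iterating [sigma_double] drops the factor [2 ^ i] of a residue [2 ^ i * 3 ^ j]; with
    [sigma_mod31], only the class [ell] will remain. *)
Lemma sigma_pow2 (A : {pred nat}) (k i n : nat) : odd n ->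
  (sigma A (2 ^ k * (2 ^ i * n)) = sigma A (2 ^ k * n) %[mod 2 ^ k])%N.
Proof.
move=> n_odd; elim: i => [|i IH]; first by rewrite mul1n.
rewrite -{}IH !mulnA -!expnD addnS.
have /(congr1 (fun a => a %% 2 ^ k)%N) := sigma_double A (k + i) n_odd.
by rewrite !modn_dvdm // dvdn_exp2l // -addnS leq_addr.
Qed.

(** * Moebius inversion *)

Lemma perm_divisors_pfactor (p e n : nat) : prime p -> (0 < n)%N -> coprime p n ->
  perm_eq (divisors (p ^ e.+1 * n))
    (divisors (p ^ e * n) ++ [seq (p ^ e.+1 * d)%N | d <- divisors n]).
Proof.
move=> p_pr n0 pn; have p0 := prime_gt0 p_pr.
have pe0 f : (0 < p ^ f * n)%N by rewrite muln_gt0 expn_gt0 p0.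
apply: uniq_perm; first exact: divisors_uniq.
  rewrite cat_uniq divisors_uniq map_inj_uniq ?divisors_uniq ?andbT /=; last first.
    by move=> a b /eqP; rewrite eqn_pmul2l ?expn_gt0 ?p0 // => /eqP.
  apply/hasPn => _ /mapP[d _ ->]; rewrite /= -dvdn_divisors //.
  apply/negP => /(dvdn_trans (dvdn_mulr d (dvdnn _))).
  rewrite Gauss_dvdl ?coprimeXl // dvdn_Pexp2l ?prime_gt1 //.
  by rewrite ltnn.
move=> d; rewrite mem_cat -!dvdn_divisors //; apply/idP/idP => [dn|/orP[dn|]].
- case: (boolP (p ^ e.+1 %| d)%N) => [/dvdnP[q dE]|ped]; apply/orP.
    right; apply/mapP; exists q; last by rewrite dE mulnC.
    by move: dn; rewrite dE mulnC dvdn_pmul2l ?expn_gt0 ?p0 // dvdn_divisors.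
  left; have d0 := dvdn_gt0 (pe0 _) dn.
  have [q pq dE] := pfactor_coprime p_pr d0.
  rewrite pfactor_dvdn // -ltnNge ltnS in ped.
  have qn : (q %| n)%N.
    rewrite -(@Gauss_dvdr q (p ^ e.+1)) ?coprimeXr 1?coprime_sym //.
    by apply: dvdn_trans dn; rewrite [X in (_ %| X)%N]dE dvdn_mulr.
  by rewrite dE mulnC dvdn_mul // dvdn_exp2l.
- by apply: dvdn_trans dn _; rewrite dvdn_mul // dvdn_exp2l.
move=> /mapP[q]; rewrite -dvdn_divisors // => qn ->.
by rewrite dvdn_pmul2l ?expn_gt0 ?p0.
Qed.

Lemma sum_divisors_pfactor (V : zmodType) (F : nat -> V) (p e n : nat) :
    prime p -> (0 < n)%N -> coprime p n ->
  \sum_(d <- divisors (p ^ e.+1 * n)) F d =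
  \sum_(d <- divisors (p ^ e * n)) F d + \sum_(d <- divisors n) F (p ^ e.+1 * d)%N.
Proof.
move=> p_pr n0 pn; rewrite (perm_big _ (perm_divisors_pfactor e p_pr n0 pn)) /=.
by rewrite big_cat big_map.
Qed.

Fixpoint iter_diff (T V : zmodType) (s : seq T) (f : T -> V) (i : T) : V :=
  if s is j :: s' then iter_diff s' f i - iter_diff s' f (i - j) else f i.

(** Difference operators commute, so the one for [j] may act first on [f] instead of last; the
    induction on primes needs this order. *)
Lemma iter_diff_comm (T V : zmodType) (s : seq T) (f : T -> V) (j i : T) :
  iter_diff s (fun x => f x - f (x - j)) i
    = iter_diff s f i - iter_diff s f (i - j).
Proof.
elim: s i => [|k s IH] i //=; rewrite !IH.
by rewrite [i - j - k]addrAC !opprB [LHS]addrACA [RHS]addrACA [in RHS](addrC (- _)).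
Qed.

(* Moebius inversion: each prime of [m] contributes one difference operator. *)
Lemma moebius_iter_diff (T V : zmodType) (l : nat -> T) (s : seq nat) (m : nat)
    (G : nat -> V) (U : T -> V) (a : T) :
    (0 < m)%N -> perm_eq (primes m) s ->
    (forall x y, (x * y %| m)%N -> l (x * y)%N = l x + l y) ->
    (forall n, (n %| m)%N -> \sum_(d <- divisors n) G d = U (a + l n)) ->
  G m = iter_diff (map l s) U (a + l m).
Proof.
elim: s m G U a => [|p s IH] m G U a m0 ps lM hG.
  have m1 : m = 1%N.
    by apply/eqP; rewrite eqn_leq m0 andbT -ltnS -primes_eq0 -size_eq0 (perm_size ps).
  by have := hG m (dvdnn m); rewrite m1 big_seq1.
have : p \in primes m by rewrite (perm_mem ps) mem_head.
rewrite mem_primes => /and3P[p_pr _ pm].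
have [m' pm' mE] := pfactor_coprime p_pr m0.
have : (0 < logn p m)%N by rewrite logn_gt0 mem_primes p_pr m0 pm.
case: (logn p m) mE => // e mE _; rewrite mulnC in mE.
have m'0 : (0 < m')%N by move: m0; rewrite mE muln_gt0 => /andP[].
have lE n : (n %| m')%N -> l (p ^ e.+1 * n)%N = l p + l (p ^ e * n)%N.
  by move=> nm; rewrite expnS -mulnA lM // mulnA -expnS mE dvdn_mul.
have lE2 n : (n %| m')%N -> l (p ^ e * n)%N = l (p ^ e)%N + l n.
  by move=> nm; rewrite lM // mE dvdn_mul // dvdn_exp2l.
(* Summing [G (p ^ e.+1 * d)] over the divisors of [n] gives the divisor sum at [p ^ e.+1 * n] minus
   that at [p ^ e * n]: a difference of [U] with step [l p], at the shifted base point. *)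
have := IH m' (fun d => G (p ^ e.+1 * d)%N) (fun x => U x - U (x - l p))
  (a + l p + l (p ^ e)%N) m'0.
rewrite -mE iter_diff_comm mE lE // lE2 // => -> /=; first by rewrite !addrA.
- have ups : uniq (p :: s) by rewrite -(perm_uniq ps) primes_uniq.
  apply: uniq_perm; first exact: primes_uniq.
    by case/andP: ups.
  move=> q; have := perm_mem ps q; rewrite mE primesM ?expn_gt0 ?(prime_gt0 p_pr) //.
  rewrite primesX // (primes_prime p_pr) !inE.
  case: eqP => [-> _|] //=; case/andP: ups => /negPf -> _.
  rewrite mem_primes; apply/negbTE; apply/negP => /and3P[_ _ pm''].
  by move: pm'; rewrite prime_coprime // pm''.
- by move=> x y xy; apply: lM; rewrite mE; exact: dvdn_mull.
move=> n nm; have n0 := dvdn_gt0 m'0 nm.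
have pn : coprime p n by apply: coprime_dvdr pm'.
have := sum_divisors_pfactor G e p_pr n0 pn.
rewrite !hG ?mE ?dvdn_mul ?dvdn_exp2l // lE // lE2 //.
move=> /(congr1 (fun z => z - U (a + (l (p ^ e)%N + l n)))).
rewrite [X in _ = X]addrAC subrr add0r => <-; congr (U _ - U _); first by rewrite !addrA.
by rewrite -[a + l p + _ + _]addrA [a + l p]addrC -[l p + a + _]addrA [l p + _]addrC addrK.
Qed.

(** The difference operator of a single prime kills constants, and [1 < m] provides a prime. *)
Lemma const_divisor_sum (V : zmodType) (H : nat -> V) (c : V) (m : nat) :
    (1 < m)%N -> (forall n, (n %| m)%N -> \sum_(d <- divisors n) H d = c) ->
  H m = 0.
Proof.
move=> m1 hH; have m0 := ltnW m1.
have -> := @moebius_iter_diff int V (fun=> 0) (primes m) m H (fun=> c) 0 m0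
  (perm_refl _) (fun _ _ _ => esym (addr0 0)) hH.
case E: (primes m) => [|p s] /=; last by rewrite subr0 subrr.
by have := primes_eq0 m; rewrite E ltnNge m1.
Qed.

(** * Residues of the divisor sums of d S(d) *)

Lemma sigma_pow2_sum (A : {pred nat}) (k n : nat) : odd n ->
  sigma A (2 ^ k * n)
    = (\sum_(d <- divisors n) \sum_(i < k.+1) chi A (2 ^ i * d) * (2 ^ i * d))%N.
Proof.
move=> n_odd; have n0 : (0 < n)%N by case: n n_odd.
have sE N : sigma A N = (\sum_(d <- divisors N) chi A d * d)%N.
  by rewrite /sigma big_mkcond; apply: eq_bigr => d _; rewrite mulnbl.
rewrite sE; elim: k => [|k IH].
  by rewrite mul1n; apply: eq_bigr => d _; rewrite big_ord1 mul1n.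
have := perm_divisors_pfactor k (isT : prime 2) n0 _; rewrite coprime2n => /(_ n_odd) pe.
rewrite (perm_big _ pe) /= big_cat /= IH big_map -big_split /=.
by apply: eq_bigr => d _; rewrite [RHS]big_ord_recr.
Qed.

Lemma res_sum (I : Type) (r : seq I) (F : I -> Z2) (f : I -> int) (k : nat) :
    (forall i, res (F i) k = (f i %% 2 ^+ k)%Z) ->
  res (\sum_(i <- r) F i) k = ((\sum_(i <- r) f i) %% 2 ^+ k)%Z.
Proof.
move=> h; elim/big_rec2: _ => [|i x y _ e]; first by rewrite res0 mod0z.
by rewrite resD h e modzDm.
Qed.

Lemma res_sum_divisors (A : {pred nat}) (n k : nat) : odd n ->
  res (\sum_(d <- divisors n) d%:R * Sser A d) k
    = ((sigma A (2 ^ k * n))%:Z %% 2 ^+ k)%Z.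
Proof.
move=> n_odd; rewrite sigma_pow2_sum // -[X in (X %% _)%Z]natz natr_sum.
apply: res_sum => d; rewrite resM res_nat res_lim2 modzMm -PoszM.
(* The term [i = k] is absent from the [k]-th partial sum of [Sser], but it is a multiple of
   [2 ^ k]. *)
rewrite big_ord_recr /= big_distrr /=; set t := (X in Posz X).
have -> : (\sum_(i < k) chi A (2 ^ i * d) * (2 ^ i * d))%N = t.
  by apply: eq_bigr => i _; lia.
have -> : (chi A (2 ^ k * d) * (2 ^ k * d) = chi A (2 ^ k * d) * d * 2 ^ k)%N.
  by rewrite -mulnA (mulnC d).
by rewrite addnC natrD natrM natrX modzMDl !natz.
Qed.

(** * Fourier analysis on Z/6 *)

Lemma vseqD x c : vseq (x + c) = vseq ((x %% 12)%Z + c).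
Proof. by rewrite /vseq modzDml. Qed.

Lemma modz12P (x : int) : exists2 r : nat, (r < 12)%N & (x %% 12)%Z = r.
Proof.
have := modz_ge0 x (isT : 12 != 0 :> int); have := ltz_pmod x (isT : 0 < 12 :> int).
by case: (x %% 12)%Z => // r r12 _; exists r.
Qed.

(** As [vseq] divides its odd entries by sqrt 3, a factor sqrt 3 joined to an odd shift of the index
    reads 3 from an even index and 1 from an odd one. *)
Definition parity3 (x : int) : int := if (2 %| x)%Z then 3 else 1.

Lemma parity3D x k : parity3 (x + 2 * k) = parity3 x.
Proof. by rewrite /parity3 rpredDr // dvdz_mulr. Qed.

(** Polar form of 1 - e^(i j pi/3): its modulus is 2 sin(j pi/6), its argument (j - 3) pi/6.
    [alpha_step] is the argument in units of pi/6 and [diffE] the modulus, with sqrt 3 carried by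
    [parity3]; both are 0 at [j = 0]. *)
Definition alpha_step (j : 'Z_6) : int := nth 0 [:: 0; -2; -1; 0; 1; 2] j.

(** Likewise for 1 - e^(2 i j pi/3): the modulus is sqrt 3 and the argument -pi/6 or pi/6 for [j]
    congruent to 1 or 2 modulo 3, and the number vanishes if 3 divides [j]. *)
Definition aexp_step (j : 'Z_6) : int := nth 0 [:: 0; -1; 1; 0; -1; 1] j.

Definition diffE (j : 'Z_6) (x : int) : int :=
  nth 0 [:: 0; 1; parity3 x; 2; parity3 x; 1] j.

Definition diffF (j : 'Z_6) (x : int) : int :=
  nth 0 [:: 0; parity3 x; parity3 x; 0; parity3 x; parity3 x] j.

Lemma parity3_mod x : parity3 x = parity3 (x %% 12)%Z.
Proof.
rewrite {1}(divz_eq x 12) addrC (_ : _ * 12 = 2 * ((x %/ 12)%Z * 6)) ?parity3D //.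
by ring.
Qed.

Lemma vseq_diffE (j : 'Z_6) x :
  vseq x - vseq (x + 2 * (j : nat)%:Z) = diffE j x * vseq (x + alpha_step j).
Proof.
rewrite /diffE parity3_mod -[in vseq x](addr0 x) !(vseqD x).
have [r r12 ->] := modz12P x.
case: j => -[|[|[|[|[|[|//]]]]]] jlt; rewrite /alpha_step /=;
  by do 12 (case: r r12 => [//|r] r12).
Qed.

Lemma vseq_diffF (j : 'Z_6) x :
  vseq x - vseq (x + 4 * (j : nat)%:Z) = diffF j x * vseq (x + aexp_step j).
Proof.
rewrite /diffF parity3_mod -[in vseq x](addr0 x) !(vseqD x).
have [r r12 ->] := modz12P x.
case: j => -[|[|[|[|[|[|//]]]]]] jlt; rewrite /aexp_step /=;
  by do 12 (case: r r12 => [//|r] r12).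
Qed.

Lemma vseq_mod x y : (x = y %[mod 12])%Z -> vseq x = vseq y.
Proof. by rewrite /vseq => ->. Qed.

Lemma Ecoef_mod A x y : (x = y %[mod 12])%Z -> Ecoef A x = Ecoef A y.
Proof.
move=> xy; apply: eq_bigr => k _; congr (_%:~R * _); apply: vseq_mod.
by rewrite -modzDml xy modzDml.
Qed.

Lemma Fcoef_mod A x y : (x = y %[mod 12])%Z -> Fcoef A x = Fcoef A y.
Proof.
move=> xy; apply: eq_bigr => k _; congr (_%:~R * _); apply: vseq_mod.
by rewrite -modzDml xy modzDml.
Qed.

Lemma Ecoef_diff A (j : 'Z_6) x :
  Ecoef A x - Ecoef A (x + 2 * (j : nat)%:Z)
    = (diffE j x)%:~R * Ecoef A (x + alpha_step j).
Proof.
rewrite /Ecoef -sumrB mulr_sumr; apply: eq_bigr => k _.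
have -> : diffE j x = diffE j (x + 2 * (k : nat)%:Z) by rewrite /diffE parity3D.
rewrite -mulrBl mulrA -rmorphB -rmorphM /= [x + _ + 2 * _]addrAC vseq_diffE.
by rewrite [x + _ + alpha_step _]addrAC.
Qed.

Lemma Fcoef_diff A (j : 'Z_6) x :
  Fcoef A x - Fcoef A (x + 4 * (j : nat)%:Z)
    = (diffF j x)%:~R * Fcoef A (x + aexp_step j).
Proof.
rewrite /Fcoef -sumrB mulr_sumr; apply: eq_bigr => k _.
have -> : diffF j x = diffF j (x + 4 * (k : nat)%:Z).
  by rewrite /diffF -[4]/(2 * 2 : int) -mulrA parity3D.
rewrite -mulrBl mulrA -rmorphB -rmorphM /= [x + _ + 4 * _]addrAC vseq_diffF.
by rewrite [x + _ + aexp_step _]addrAC.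
Qed.

Lemma Z6_sub (i j : 'Z_6) :
  ((((i - j)%R : 'Z_6) : nat)%:Z = (i : nat)%:Z - (j : nat)%:Z %[mod 6])%Z.
Proof.
by case: i => -[|[|[|[|[|[|//]]]]]] ilt; case: j => -[|[|[|[|[|[|//]]]]]] jlt.
Qed.

Lemma odd_Z6_sub (i j : 'Z_6) : odd (i - j)%R = odd i (+) odd j.
Proof.
by case: i => -[|[|[|[|[|[|//]]]]]] ilt; case: j => -[|[|[|[|[|[|//]]]]]] jlt.
Qed.

(** Orthogonality of characters: the four terms sum the (k - i)-th powers of the sixth roots of
    unity of order 6, of order 3, of order 2 and of order 1. *)
Lemma fourier6 (i k : 'I_6) :
  vseq (0 - 2 * (i : nat)%:Z + 2 * (k : nat)%:Z)
    + vseq (0 - 4 * (i : nat)%:Z + 4 * (k : nat)%:Z)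
    + (-1) ^+ i * (-1) ^+ k + 1 = (6 * (i == k))%N%:Z.
Proof.
by case: i => -[|[|[|[|[|[|//]]]]]] ilt; case: k => -[|[|[|[|[|[|//]]]]]] jlt.
Qed.

(** Fourier inversion for [Uj A], the base case of [iter_diff_closed]; the leading 0 is the empty
    sum of steps. *)
Lemma iter_diff_nil A (i : 'Z_6) :
  6%:R * Uj A i = Ecoef A (0 - 2 * (i : nat)%:Z) + Fcoef A (0 - 4 * (i : nat)%:Z)
    + (-1) ^+ i * Gcoef A + \sum_(k < 6) Uj A k.
Proof.
rewrite /Gcoef mulr_sumr -!big_split /=.
under eq_bigr => k _.
  have -> : (vseq (0 - 2 * (i : nat)%:Z + 2 * (k : nat)%:Z))%:~R * Uj A k
      + (vseq (0 - 4 * (i : nat)%:Z + 4 * (k : nat)%:Z))%:~R * Uj A k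
      + (-1) ^+ i * ((-1) ^+ k * Uj A k) + Uj A k
    = ((6 * (i == k :> 'I_6))%N)%:R * Uj A k.
    rewrite [X in _ = X * _]pmulrn -fourier6 !rmorphD rmorphM !rmorphXn /= rmorphN rmorph1.
    ring.
  over.
rewrite (bigD1 (i : 'I_6)) //= eqxx muln1 big1 ?addr0 // => k ki.
by rewrite eq_sym (negbTE ki) muln0 mul0r.
Qed.

(** Only the classes 2 and 4 shift the index by an odd step. *)
Lemma parity3_sum_alpha (s : seq 'Z_6) x :
  parity3 (\sum_(j <- s) alpha_step j - 2 * x)
    = if odd (count_mem 2 s + count_mem 4 s) then 1 else 3.
Proof.
rewrite -mulrN parity3D; elim: s => [|j s IH]; first by rewrite big_nil.
(* Subtraction from 4 exchanges the values 1 and 3. *)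
have h y : parity3 (1 + y) = 4 - parity3 y.
  by rewrite (parity3_mod (_ + _)) -modzDmr -parity3_mod (parity3_mod y);
     have [r r12 ->] := modz12P y; do 12 (case: r r12 => [//|r] r12).
have h2 y : parity3 (-2 + y) = parity3 y by rewrite addrC -(parity3D y (-1)).
have h3 y : parity3 (2 + y) = parity3 y by rewrite addrC -(parity3D y 1).
have h4 y : parity3 (-1 + y) = 4 - parity3 y by rewrite -h -h3; congr parity3; ring.
rewrite big_cons.
case: j => -[|[|[|[|[|[|//]]]]]] jlt; rewrite /alpha_step /= ?add0r ?h ?h2 ?h3 ?h4 IH //;
by rewrite ?(addSn, addnS, add0n) /=; case: ifP => // ->.
Qed.

(** The classes left, 1, 2, 4 and 5, all have step 1 or -1. *)
Lemma parity3_sum_aexp (s : seq 'Z_6) x : 0 \notin s -> count_mem 3 s = 0%N ->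
  parity3 (\sum_(j <- s) aexp_step j - 4 * x) = if odd (size s) then 1 else 3.
Proof.
rewrite -mulrN -[4]/(2 * 2 : int) -mulrA parity3D.
elim: s => [|j s IH]; first by rewrite big_nil.
have h y : parity3 (1 + y) = 4 - parity3 y.
  by rewrite (parity3_mod (_ + _)) -modzDmr -parity3_mod (parity3_mod y);
     have [r r12 ->] := modz12P y; do 12 (case: r r12 => [//|r] r12).
have h3 y : parity3 (2 + y) = parity3 y by rewrite addrC -(parity3D y 1).
have h4 y : parity3 (-1 + y) = 4 - parity3 y by rewrite -h -h3; congr parity3; ring.
rewrite big_cons inE negb_or => /andP[j0 s0].
case: j j0 => -[|[|[|[|[|[|//]]]]]] jlt //= _; rewrite ?add0n // => c3;
  rewrite /aexp_step /= ?h ?h4 IH //; by case: ifP => // ->.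
Qed.

(** Successive factors sqrt 3 read alternately 3 and 1, which produces the ceiling of n/2 as
    exponent. *)
Lemma expr3_uphalfS n :
  3 ^+ uphalf n * (if odd n then 1 else 3 : int)%:~R = 3 ^+ uphalf n.+1 :> Z2.
Proof.
rewrite uphalf_half /=; case: (odd n) => /=; rewrite ?add0n ?add1n ?mulr1 //.
by rewrite exprSr.
Qed.

(** Each class [j] multiplies the four Fourier components by its eigenvalue: [diffE] with a shift on
    [Ecoef], [diffF] with a shift on [Fcoef], 1 - (-1)^j on [Gcoef], and 0 on the constant one. The
    powers of 0 record which components have been killed. *)
Lemma iter_diff_closed A (s : seq 'Z_6) (i : 'Z_6) : 0 \notin s ->
  6%:R * iter_diff s (Uj A) i =
    2 ^+ count_mem 3 s * 3 ^+ uphalf (count_mem 2 s + count_mem 4 s)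
      * Ecoef A (\sum_(j <- s) alpha_step j - 2 * (i : nat)%:Z)
    + 0 ^+ count_mem 3 s * 3 ^+ uphalf (size s)
      * Fcoef A (\sum_(j <- s) aexp_step j - 4 * (i : nat)%:Z)
    + 0 ^+ (count_mem 2 s + count_mem 4 s) * 2 ^+ size s * (-1) ^+ i * Gcoef A
    + 0 ^+ size s * \sum_(k < 6) Uj A k.
Proof.
elim: s i => [|j s IH] i.
  by move=> _ /=; rewrite iter_diff_nil !big_nil !expr0 !mul1r.
rewrite inE negb_or => /andP[j0 s0].
rewrite [iter_diff _ _ _]/= mulrBr !IH // !big_cons.
set a := \sum_(j <- s) alpha_step j; set b := \sum_(j <- s) aexp_step j.
have -> : Ecoef A (a - 2 * ((i - j)%R : nat)%:Z)
    = Ecoef A (a - 2 * (i : nat)%:Z + 2 * (j : nat)%:Z).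
  apply: Ecoef_mod; apply/eqP; rewrite eqz_mod_dvd.
  have /eqP := Z6_sub i j; rewrite eqz_mod_dvd => /dvdzP[q hq].
  by apply/dvdzP; exists (- q); lia.
have -> : Fcoef A (b - 4 * ((i - j)%R : nat)%:Z)
    = Fcoef A (b - 4 * (i : nat)%:Z + 4 * (j : nat)%:Z).
  apply: Fcoef_mod; apply/eqP; rewrite eqz_mod_dvd.
  have /eqP := Z6_sub i j; rewrite eqz_mod_dvd => /dvdzP[q hq].
  by apply/dvdzP; exists (- 2 * q); lia.
have -> : (-1) ^+ (i - j)%R = (-1) ^+ i * (-1) ^+ j :> Z2.
  by rewrite -signr_odd odd_Z6_sub signr_addb !signr_odd.
set x := a - 2 * (i : nat)%:Z; set y := b - 4 * (i : nat)%:Z.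
have -> : Ecoef A (x + 2 * (j : nat)%:Z)
    = Ecoef A x - (diffE j x)%:~R * Ecoef A (alpha_step j + a - 2 * (i : nat)%:Z).
  have -> : alpha_step j + a - 2 * (i : nat)%:Z = x + alpha_step j by rewrite /x; ring.
  by rewrite -Ecoef_diff; ring.
have -> : Fcoef A (y + 4 * (j : nat)%:Z)
    = Fcoef A y - (diffF j y)%:~R * Fcoef A (aexp_step j + b - 4 * (i : nat)%:Z).
  have -> : aexp_step j + b - 4 * (i : nat)%:Z = y + aexp_step j by rewrite /y; ring.
  by rewrite -Fcoef_diff; ring.
have hE : 2 ^+ count_mem 3 s * 3 ^+ uphalf (count_mem 2 s + count_mem 4 s)
      * (diffE j x)%:~R
    = 2 ^+ count_mem 3 (j :: s)
      * 3 ^+ uphalf (count_mem 2 (j :: s) + count_mem 4 (j :: s)) :> Z2.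
  rewrite /diffE parity3_sum_alpha.
  case: j j0 => -[|[|[|[|[|[|//]]]]]] jlt //= _; rewrite ?mulr1 ?add0n ?add1n ?addnS //.
  - by rewrite -mulrA; congr (_ * _); exact: expr3_uphalfS.
  - by rewrite exprS mulrC mulrA.
  - by rewrite -mulrA; congr (_ * _); exact: expr3_uphalfS.
have hF : 0 ^+ count_mem 3 s * 3 ^+ uphalf (size s) * (diffF j y)%:~R
    = 0 ^+ count_mem 3 (j :: s) * 3 ^+ uphalf (size (j :: s)) :> Z2.
  (* Once class 3 has occurred both sides are 0; otherwise [parity3_sum_aexp] gives the parity of
     [y]. *)
  case: (posnP (count_mem 3 s)) => c3; last first.
    by rewrite /= expr0n gtn_eqF // expr0n addn_eq0 [_ s == 0%N]gtn_eqF // andbF !mul0r.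
  rewrite /diffF parity3_sum_aexp // -mulrA {hE}.
  case: j j0 => -[|[|[|[|[|[|//]]]]]] jlt //= _; rewrite ?add0n ?expr3_uphalfS ?c3 //.
  by rewrite expr1 mul0r !mulr0.
have hG : 0 ^+ (count_mem 2 s + count_mem 4 s) * 2 ^+ size s * (1 - (-1) ^+ j)
    = 0 ^+ (count_mem 2 (j :: s) + count_mem 4 (j :: s)) * 2 ^+ size (j :: s) :> Z2.
  clear hE hF; case: j j0 => -[|[|[|[|[|[|//]]]]]] jlt //= _;
    rewrite ?add0n ?add1n ?addnS ?addSn ?exprS ?expr0; ring.
rewrite -hE -hF -hG [size (j :: s)]/= [0 ^+ (size s).+1]exprS; ring.
Qed.

(** * The index [ell] and the theorem *)

(** The products [2 ^ k * 3 ^ j] reach all 30 nonzero residues, by computation, so the default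
    [ord0] is not returned here. *)
Lemma ell_spec n : ~~ (31 %| n)%N ->
  exists k, (n = 2 ^ k * 3 ^ ell n %[mod 31])%N.
Proof.
move=> n31; rewrite /ell; case: pickP => [j /existsP[k /eqP e]|h]; first by exists k.
have all31 : all (fun r => has (fun k => has (fun j =>
    r == 2 ^ k * 3 ^ j %[mod 31]) (iota 0 6)) (iota 0 5))%N (iota 1 30).
  by vm_compute.
have : (n %% 31)%N \in iota 1 30 by rewrite mem_iota lt0n n31 ltn_mod.
move=> /(allP all31) /hasP[k + /hasP[j + e]]; rewrite !mem_iota /= => k5 j6.
have /negP[] := negbT (h (Ordinal j6)); apply/existsP; exists (Ordinal k5).
by rewrite -(eqP e) modn_mod.
Qed.

Lemma ell_lt6 n : (ell n < 6)%N.
Proof. exact: ltn_ord. Qed.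

(* [26 = 3 ^ 5] has order 6 modulo 31, while [2 ^ 5 = 1]. *)
Lemma ell_pow5 n : ~~ (31 %| n)%N -> (n ^ 5 = 26 ^ ell n %[mod 31])%N.
Proof.
move=> /ell_spec[k e]; rewrite -modnXm e modnXm.
have -> : ((2 ^ k * 3 ^ ell n) ^ 5 = 32 ^ k * 243 ^ ell n)%N.
  by rewrite expnMn -!expnM !(mulnC _ 5) !expnM.
rewrite -modnMm -(modnXm k 31 32) -(modnXm _ 31 243).
by rewrite (_ : 32 %% 31 = 1)%N // (_ : 243 %% 31 = 26)%N // exp1n modnMm mul1n.
Qed.

(** The bound 12 on [b] leaves room for a sum of two values of [ell]. *)
Lemma pow26_mod31 a b : (a < 6)%N -> (b < 12)%N ->
  (26 ^ a = 26 ^ b %[mod 31])%N -> a = (b %% 6)%N.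
Proof.
(* Reducing at each multiplication keeps the unary numbers of the table small. *)
have iterE c : (26 ^ c %% 31 = iter c (fun x => x * 26 %% 31) 1)%N.
  by elim: c => [//|c IH]; rewrite iterS -IH expnSr modnMml.
have tab : all (fun a => all (fun b => (iter a (fun x => x * 26 %% 31) 1 ==
    iter b (fun x => x * 26 %% 31) 1) ==> (a == b %% 6)) (iota 0 12))%N (iota 0 6).
  by vm_compute.
move=> a6 b12 e.
have := allP tab a; rewrite mem_iota a6 => /(_ isT) /allP /(_ b).
by rewrite mem_iota b12 -!iterE e eqxx => /(_ isT) /eqP.
Qed.

Lemma val_ell n : ((ell n)%:R : 'Z_6) = ell n :> nat.
Proof. by rewrite val_Zp_nat // modn_small ?ell_lt6. Qed.

(** By [ell_pow5] the class is read off [n ^ 5], which is multiplicative in [n]. *)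
Lemma ellM m n : ~~ (31 %| m * n)%N ->
  (ell (m * n))%:R = (ell m)%:R + (ell n)%:R :> 'Z_6.
Proof.
move=> mn; have := mn; rewrite Euclid_dvdM // negb_or => /andP[m31 n31].
have e : (26 ^ ell (m * n) = 26 ^ (ell m + ell n) %[mod 31])%N.
  by rewrite -ell_pow5 // expnMn expnD -modnMm !ell_pow5 // modnMm.
apply: val_inj; rewrite -natrD [LHS]val_ell [RHS]val_Zp_nat //.
apply: pow26_mod31 => //; first exact: ell_lt6.
by rewrite -[12%N]/(6 + 6)%N -addnS leq_add ?ell_lt6 // ltnW ?ell_lt6.
Qed.

(** * Divisor sums of d S(d), and the value of S at 31m *)

Lemma sum_divisors_Sser (A : {pred nat}) n : parity_set A -> odd n ->
    ~~ (31 %| n)%N ->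
  \sum_(d <- divisors n) d%:R * Sser A d = Uj A ((ell n)%:R : 'Z_6).
Proof.
move=> HA n_odd n31; apply: Z2_ext => k; rewrite res_sum_divisors //.
have [i e] := ell_spec n31; have n0 : (0 < n)%N by case: n n_odd {n31 e}.
have -> : Uj A ((ell n)%:R : 'Z_6) = Uj A (Ordinal (ell_lt6 n)).
  by congr Uj; apply: val_inj; rewrite [LHS]val_ell.
have h0 : (0 < 2 ^ i * 3 ^ ell n)%N by rewrite muln_gt0 !expn_gt0.
rewrite res_lim2 /=.
(* [n] is replaced by [2 ^ i * 3 ^ ell n], congruent to it modulo 31, and then [2 ^ i] is
   dropped. *)
have := sigma_mod31 k HA n0 h0 e; rewrite sigma_pow2 ?oddX ?orbT // => es.
by rewrite -[2 ^+ k](natrX int 2) natz !modz_nat es.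
Qed.

(** Both [31 * n] and 31 are 0 modulo 31, so [sigma_mod31] identifies the two sums modulo every
    power of 2. *)
Lemma sum_divisors_Sser31 (A : {pred nat}) n : parity_set A -> odd n ->
  \sum_(d <- divisors (31 * n)) d%:R * Sser A d
    = \sum_(d <- divisors 31) d%:R * Sser A d.
Proof.
move=> HA n_odd; apply: Z2_ext => k; rewrite !res_sum_divisors ?oddM //.
have n0 : (0 < n)%N by case: n n_odd.
have := @sigma_mod31 A k (31 * n) 31 HA _ isT _; rewrite muln_gt0 n0 modnMr.
move=> /(_ isT erefl) es.
by rewrite -[2 ^+ k](natrX int 2) natz !modz_nat es.
Qed.

Lemma Sser_31M (A : {pred nat}) m : parity_set A -> (1 < m)%N -> odd m ->
  ~~ (31 %| m)%N -> Sser A (31 * m) = - 31%:R^-1 * Sser A m.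
Proof.
move=> HA m1 m_odd m31; have m0 := ltnW m1.
have : m%:R * Sser A m + (31 * m)%N%:R * Sser A (31 * m) = 0.
  (* The divisors of [31 * n] are the [d] and [31 * d] with [d] dividing [n], so this summand
     regroups the divisor sum at [31 * n], which is independent of [n]. *)
  apply: (@const_divisor_sum _ (fun d => d%:R * Sser A d
      + (31 * d)%N%:R * Sser A (31 * d))
    (\sum_(d <- divisors 31) d%:R * Sser A d)) => // n nm.
  have n0 := dvdn_gt0 m0 nm.
  rewrite -(sum_divisors_Sser31 HA (dvdn_odd nm m_odd)) big_split /=.
  have := @sum_divisors_pfactor _ (fun d => d%:R * Sser A d) 31 0 n isT n0.
  rewrite expn0 expn1 mul1n => -> //; rewrite prime_coprime //.
  by apply: contra m31 => /dvdn_trans; apply.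
rewrite natrM [31%:R * _]mulrC -mulrA -mulrDr => /eqP; rewrite mulf_eq0.
case/orP=> [/eqP h|]; first by have := odd_unit2 m_odd; rewrite h unitr0.
rewrite addrC addr_eq0 => /eqP h.
by rewrite mulNr -mulrN -h mulKr // odd_unit2.
Qed.

(** * Comparison of the five lowest binary digits *)

Lemma binary_digits_inj (a b : nat -> bool) (n : nat) :
    (\sum_(i < n) a i * 2 ^ i = \sum_(i < n) b i * 2 ^ i %[mod 2 ^ n])%N ->
  forall k, (k < n)%N -> a k = b k.
Proof.
elim: n => // n IH; rewrite !big_ord_recr /= => e.
have {}IH : forall k, (k < n)%N -> a k = b k.
  apply: IH; move: e => /(congr1 (fun x => x %% 2 ^ n)%N).
  by rewrite !modn_dvdm ?dvdn_exp2l // !(addnC _ (_ * 2 ^ n)%N) !modnMDl.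
move=> k; rewrite ltnS leq_eqVlt => /predU1P[->|/IH //].
have ab : (\sum_(i < n) a i * 2 ^ i = \sum_(i < n) b i * 2 ^ i)%N.
  by apply: eq_bigr => i _; rewrite IH.
move/eqP: e; rewrite ab eqn_modDl expnS.
have n0 : (0 < 2 ^ n)%N by rewrite expn_gt0.
case: (a n) (b n) => [] [] //; rewrite ?mul1n mul0n mod0n ?modn_small //;
  by rewrite ?[_ == 0%N]gtn_eqF ?[0%N == _]ltn_eqF // mul2n -addnn
    -[X in (X < _)%N]addn0 ltn_add2l.
Qed.

(** As 31 is -1 modulo 2^5, the relation makes S(m) and S(31m) congruent modulo 2^5; hence the bound
    5 on [k]. *)
Lemma mem_31M (A : {pred nat}) m k :
    Sser A (31 * m) = - 31%:R^-1 * Sser A m -> (k < 5)%N ->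
  ((2 ^ k * m)%N \in A) = ((31 * (2 ^ k * m))%N \in A).
Proof.
move=> h k5.
have inv_mul (u x y : Z2) : u \is a GRing.unit -> y = - u^-1 * x -> x = - (u * y).
  by move=> uU ->; rewrite mulNr mulrN opprK mulVKr.
have {}h := inv_mul _ _ _ (odd_unit2 (isT : odd 31)) h.
have := congr1 (fun x => res x 5) h; rewrite resN resM res_nat !res_lim2.
rewrite modzMm modzNm; set x := \sum_(i < 5) _; set y := \sum_(i < 5) _.
have -> : - (31%N%:Z * y%:Z) = (- y%:Z) * 2 ^+ 5 + y%:Z by ring.
rewrite modzMDl -[2 ^+ 5]/((2 ^ 5)%N%:Z) !modz_nat => -[e].
rewrite mulnCA; exact: (binary_digits_inj (a := fun i => (2 ^ i * m)%N \in A)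
  (b := fun i => (2 ^ i * (31 * m))%N \in A) e k5).
Qed.

(** * Translation into the stated formula *)

Lemma ceil_half_sub1 n : Num.ceil (n%:R / 2 - 1 : rat) = (uphalf n)%:Z - 1.
Proof.
apply: ceil_def; rewrite !rmorphB /= -!pmulrn uphalf_half.
have -> : n%:R = (odd n)%:R + 2 * n./2%:R :> rat.
  by rewrite -{1}(odd_double_half n) -mul2n natrD natrM.
by rewrite natrD; case: (odd n) => /=; apply/andP; split; lra.
Qed.

Lemma omega_count j m : (j < 6)%N -> odd m -> ~~ (31 %| m)%N ->
  omega j m = count_mem (j%:R : 'Z_6) [seq (ell p)%:R : 'Z_6 | p <- primes m].
Proof.
move=> j6 m_odd m31; rewrite /omega [RHS]count_map; apply: eq_in_count => p.
rewrite mem_primes => /and3P[p_pr m0 pm]; rewrite /inPj p_pr (dvdn_odd pm m_odd) /=.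
have -> : p != 31%N by apply: contra m31 => /eqP <-.
by rewrite -val_eqE /= [X in _ = (X == _)]val_ell [X in _ = (_ == X)]val_Zp_nat // modn_small.
Qed.

Lemma sum_alpha_step (s : seq 'Z_6) :
  \sum_(j <- s) alpha_step j
    = 2 * (count_mem 5 s)%:Z - 2 * (count_mem 1 s)%:Z
      + (count_mem 4 s)%:Z - (count_mem 2 s)%:Z.
Proof.
elim: s => [|j s IH]; first by rewrite big_nil.
rewrite big_cons IH /= !PoszD.
case: j => -[|[|[|[|[|[|//]]]]]] jlt; rewrite /alpha_step /=; ring.
Qed.

Lemma sum_aexp_step (s : seq 'Z_6) :
  \sum_(j <- s) aexp_step j
    = (count_mem 5 s)%:Z - (count_mem 1 s)%:Z
      + (count_mem 2 s)%:Z - (count_mem 4 s)%:Z.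
Proof.
elim: s => [|j s IH]; first by rewrite big_nil.
rewrite big_cons IH /= !PoszD.
case: j => -[|[|[|[|[|[|//]]]]]] jlt; rewrite /aexp_step /=; ring.
Qed.

Lemma size_count_Z6 (s : seq 'Z_6) : 0 \notin s ->
  size s = (count_mem 1%R s + count_mem 2%R s + count_mem 3%R s
            + count_mem 4%R s + count_mem 5%R s)%N.
Proof.
elim: s => // j s IH; rewrite inE negb_or => /andP[j0 s0]; rewrite /= IH //.
by case: j j0 => -[|[|[|[|[|[|//]]]]]] jlt //= _; lia.
Qed.

Lemma tofrac_nat_neq0 (n : nat) : (0 < n)%N -> n%:R != 0 :> Q2.
Proof.
move=> n0; rewrite -tofrac1 -tofracMn tofrac_eq0.
(* Since [n < 2 ^ n], the residue of [n] modulo [2 ^ n] is [n] itself. *)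
apply/eqP => h; have := res_nat n n; rewrite h res0 -[2 ^+ n](natrX int 2).
by rewrite natz modz_nat modn_small; [case: n n0 {h} | exact: ltn_expl].
Qed.

(** 1/6 splits as 1/2 times 1/3; each factor goes to the power of 2 or 3 present in the term, and
    otherwise to [z1] or [z2], which stand for the powers of 0. *)
Lemma divide_by_6 (F : fieldType) (X E F' G z1 z2 e : F) (c h h' w : nat) :
    2 != 0 :> F -> 3 != 0 :> F ->
    6%:R * X = 2 ^+ c * 3 ^+ h * E + z1 * 3 ^+ h' * F' + z2 * 2 ^+ w * e * G ->
  X = 2 ^ (c%:Z - 1) * 3 ^ (h%:Z - 1) * E + z1 / 2 * 3 ^ (h'%:Z - 1) * F'
    + z2 / 3 * 2 ^ (w%:Z - 1) * e * G.
Proof.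
move=> n2 n3 eX; have expB1 (x : F) (n : nat) : x != 0 -> x ^ (n%:Z - 1) = x ^+ n / x.
  by move=> x0; rewrite expfzDr // exprN1.
have n6 : 6%:R != 0 :> F by rewrite -[6%N]/(2 * 3)%N natrM mulf_neq0.
by apply: (mulfI n6); rewrite eX !expB1 //; field; apply/andP.
Qed.

Theorem theorem1 (A : {pred nat}) (HA : parity_set A) (m : nat)
    (m_neq1 : m != 1%N) (m_odd : odd m) (m_31 : ~~ (31 %| m)%N)
    (m_P0 : forall p : nat, (p %| m)%N -> ~~ inPj 0 p) :
  let w1 := omega 1 m in
  let w2 := omega 2 m in
  let w3 := omega 3 m in
  let w4 := omega 4 m in
  let w5 := omega 5 m in
  let w := (w1 + w2 + w3 + w4 + w5)%N in
  let l := (ell m)%:Z in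
  (m%:R * tofrac (Sser A m) =
     2 ^ (w3%:Z - 1) * 3 ^ Num.ceil ((w2 + w4)%N%:R / 2 - 1 : rat)
       * tofrac (Ecoef A (alpha m - 2 * l))
     + 0 ^+ w3 / 2 * 3 ^ Num.ceil (w%:R / 2 - 1 : rat)
       * tofrac (Fcoef A (aexp m - 4 * l))
     + 0 ^+ (w2 + w4)%N / 3 * 2 ^ (w%:Z - 1) * (-1) ^+ ell m
       * tofrac (Gcoef A) :> Q2)
  /\ (Sser A (31 * m) = - 31%:R^-1 * Sser A m
      /\ forall k : nat, (k < 5)%N ->
           ((2 ^ k * m)%N \in A <-> (31 * (2 ^ k * m))%N \in A)).
Proof.
have m0 : (0 < m)%N by case: m m_odd {m_neq1 m_31 m_P0}.
have m1 : (1 < m)%N by rewrite ltn_neqAle eq_sym m_neq1.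
have S31 := Sser_31M HA m1 m_odd m_31.
move=> w1 w2 w3 w4 w5 w l; split; last first.
  by split=> // k k5; rewrite (mem_31M S31 k5).
pose s := [seq (ell p)%:R : 'Z_6 | p <- primes m].
have hw j : (j < 6)%N -> omega j m = count_mem (j%:R : 'Z_6) s.
  by move=> j6; apply: omega_count.
have s0 : 0 \notin s.
  apply/mapP => -[p]; rewrite mem_primes => /and3P[p_pr _ pm] /esym p0.
  have /negP[] := m_P0 p pm; rewrite /inPj p_pr (dvdn_odd pm m_odd) /=.
  apply/andP; split; first by apply: contra m_31 => /eqP <-.
  by rewrite -val_ell p0.
have wE : size s = w by rewrite size_count_Z6 // /w /w1 /w2 /w3 /w4 /w5 !hw.
(* [m] has a prime factor, so the trivial character, the last term of [iter_diff_closed],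
   contributes nothing. *)
have w0 : (0 < w)%N.
  rewrite -wE size_map lt0n size_eq0; apply/negP => /eqP e.
  by have := primes_eq0 m; rewrite e ltnNge m1.
have GE : m%:R * Sser A m = iter_diff s (Uj A) ((ell m)%:R : 'Z_6).
  rewrite -[(ell m)%:R]add0r.
  apply: (@moebius_iter_diff _ _ (fun n => (ell n)%:R : 'Z_6) _ m
    (fun d => d%:R * Sser A d) (Uj A) 0) => //.
    by move=> x y xy; apply: ellM; apply: contra m_31 => /dvdn_trans; apply.
  move=> n nm; rewrite add0r sum_divisors_Sser ?(dvdn_odd nm) //.
  by apply: contra m_31 => /dvdn_trans; apply.
have := iter_diff_closed A ((ell m)%:R : 'Z_6) s0.
rewrite -GE sum_alpha_step sum_aexp_step val_ell wE.
rewrite -[count_mem 1 s](hw 1%N) // -!hw //.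
rewrite -/(alpha m) -/(aexp m) [0 ^+ w]expr0n gtn_eqF // mul0r addr0 => main.
rewrite !ceil_half_sub1.
apply: divide_by_6; [exact: tofrac_nat_neq0 | exact: tofrac_nat_neq0 |].
have := congr1 (@tofrac Z2) main.
by rewrite tofracM !tofracD !tofracM !tofracXn tofracN !tofracMn tofrac0 tofrac1.
Qed.
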